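(* Let $\mathbb{F}$ be either $\mathbb{R}$ or $\mathbb{C}$, let $X$ be an infinite-dimensional vector space over $\mathbb{F}$, and let $N$ be a norm on $X$. Then there exists a proper seminorm $S$ on $X$ which is ubiquitously continuous in $X$ with respect to $N$.
   Context: A seminorm on $X$ is a function $S\colon X\to\mathbb{R}$ with $S(x)\ge 0$, $S(\alpha x)=|\alpha|S(x)$ and $S(x+y)\le S(x)+S(y)$ for all $x,y\in X$, $\alpha\in\mathbb{F}$; a norm is a seminorm with $S(x)>0$ for all $x\neq 0$. A seminorm $S$ is called proper if it does not vanish identically and $S(x)=0$ for some $x\neq 0$ (equivalently, $\ker S=\{x\in X: S(x)=0\}$ is a nontrivial proper subspace of $X$). A function $X\to\mathbb{R}$ is ubiquitously continuous in $X$ with respect to a norm $N$ if it is continuous at every point of $X$ in the topology on $X$ induced by $N$. *)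

(* Defs.v *)
From HB Require Import structures.
From mathcomp Require Import all_boot all_order all_algebra.
From mathcomp Require Import all_classical all_reals all_analysis.
From mathcomp Require Import complex.
Set Implicit Arguments.
Unset Strict Implicit.
Unset Printing Implicit Defensive.
Import Order.TTheory GRing.Theory Num.Theory.
Import numFieldNormedType.Exports.
Local Open Scope classical_set_scope.
Local Open Scope ring_scope.

Variant scalar_kind := RealScalars | ComplexScalars.

Definition scalars (R : realType) (k : scalar_kind) : numFieldType :=
  match k with
  | RealScalars => R
  | ComplexScalars => R[i]
  end.

(* The library's norm of z : R[i] is itself an element of R[i], with zero
   imaginary part; [complex.Re] reads it as a real number. *)
Definition modulus (R : realType) (k : scalar_kind) : scalars R k -> R :=
  match k with
  | RealScalars => fun a : R => `|a|
  | ComplexScalars => fun a : R[i] => complex.Re `|a|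
  end.

Lemma modulus0 (R : realType) (k : scalar_kind) : modulus (0 : scalars R k) = 0.
Proof.
case: k => /=; first exact: (@normr0 R R).
exact: (congr1 (@complex.Re R) (@normr0 R[i] R[i])).
Qed.

Lemma modulusN1 (R : realType) (k : scalar_kind) :
  modulus (-1 : scalars R k) = 1.
Proof.
case: k => /=; first exact: (@normrN1 R).
exact: (congr1 (@complex.Re R) (@normrN1 R[i])).
Qed.

Record seminorm_on (R : realType) (k : scalar_kind) (X : lmodType (scalars R k))
    (S : X -> R) : Prop := {
  seminorm_ge0 : forall x, 0 <= S x;
  seminormZ : forall (a : scalars R k) x, S (a *: x) = modulus a * S x;
  seminormD : forall x y, S (x + y) <= S x + S y
}.

Record norm_on (R : realType) (k : scalar_kind) (X : lmodType (scalars R k))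
    (N : X -> R) : Prop := {
  norm_seminorm : seminorm_on N;
  norm_gt0 : forall x, x != 0 -> 0 < N x
}.

Definition proper_seminorm (R : realType) (k : scalar_kind)
    (X : lmodType (scalars R k)) (S : X -> R) : Prop :=
  [/\ seminorm_on S, exists x, S x != 0 & exists2 x, x != 0 & S x = 0].

(* [Vector.axiom n X] is the type of linear bijections from X to F^n. *)
Definition infinite_dimensional (F : fieldType) (X : lmodType F) : Prop :=
  forall n : nat, ~ inhabited (Vector.axiom n X).

(* The carrier X with the topology induced by the norm N, as the metric space
   whose balls are [set y | N (x - y) < e]. *)
Definition normed_by (R : realType) (k : scalar_kind)
  (X : lmodType (scalars R k)) (N : X -> R) (hN : norm_on N) : Type := X.

Section NormedBy.
Context {R : realType} {k : scalar_kind} {X : lmodType (scalars R k)}.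
Context {N : X -> R} (hN : norm_on N).

Let ball : normed_by hN -> R -> set (normed_by hN) := ball_ N.

Let ball_center (x : normed_by hN) (e : R) : 0 < e -> ball x e x.
Proof.
have N0 : N 0 = 0.
  by rewrite -(scale0r 0) (seminormZ (norm_seminorm hN)) modulus0 mul0r.
by rewrite /ball /ball_ /= subrr N0.
Qed.

Let ball_sym (x y : normed_by hN) (e : R) : ball x e y -> ball y e x.
Proof.
have NN (z : X) : N (- z) = N z.
  by rewrite -scaleN1r (seminormZ (norm_seminorm hN)) modulusN1 mul1r.
by rewrite /ball /ball_ /= -(opprB y) NN.
Qed.

Let ball_triangle (x y z : normed_by hN) (e1 e2 : R) :
  ball x e1 y -> ball y e2 z -> ball x (e1 + e2) z.
Proof.
rewrite /ball /ball_ /= => xy yz.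
rewrite -(subrKA (y : X)).
exact: le_lt_trans (seminormD (norm_seminorm hN) _ _) (ltrD xy yz).
Qed.

HB.instance Definition _ := Choice.copy (normed_by hN) X.
HB.instance Definition _ :=
  hasNbhs.Build (normed_by hN) (nbhs_ (entourage_ ball)).
HB.instance Definition _ := Nbhs_isPseudoMetric.Build R (normed_by hN)
  erefl ball_center ball_sym ball_triangle erefl.

End NormedBy.

Definition ubiquitously_continuous (R : realType) (k : scalar_kind)
    (X : lmodType (scalars R k)) (N : X -> R) (hN : norm_on N)
    (f : X -> R) : Prop :=
  continuous (f : normed_by hN -> R).

(* Main.v *)
Require Import Defs.
From mathcomp Require Import all_boot all_order all_algebra.
From mathcomp Require Import all_classical all_reals all_analysis.
From mathcomp Require Import complex.
From mathcomp Require Import lra.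

(** Pick linearly independent vectors [v] and [w], and let [S x] be the
    distance from [x] to the line spanned by [v], measured by [N].  This is the
    quotient seminorm: it vanishes at [v], and it is bounded by [N], hence
    1-Lipschitz for [N] and so continuous.

    The point that needs an argument is [S w != 0], i.e. that the line is closed.
    It holds because the scalar field is locally compact (over the rationals it
    fails: in Q^2 with the norm |a + b sqrt 2| every line is dense).  The
    function [a |-> N (x - a *: v)] is Lipschitz and, as [N v > 0], grows
    linearly, so it attains its minimum ([lipschitz_coercive_min]).  Thus [S x]
    is the distance to an actual nearest point, and [S x = 0] forces [x] onto
    the line.  Having a minimum also makes the seminorm axioms for [S] a direct
    comparison with competitors ([dist_line_seminorm]). *)

Set Implicit Arguments.
Unset Strict Implicit.
Unset Printing Implicit Defensive.
Import Order.TTheory GRing.Theory Num.Theory.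
Import numFieldNormedType.Exports.
Local Open Scope classical_set_scope.
Local Open Scope complex_scope.
Local Open Scope ring_scope.

Lemma modulus_complex (R : realType) (a : R[i]) :
  modulus (a : scalars R ComplexScalars)
  = Num.sqrt (complex.Re a ^+ 2 + complex.Im a ^+ 2).
Proof. exact: (congr1 (@complex.Re R) (normc_def a)). Qed.

Lemma modulus_ge0 (R : realType) (k : scalar_kind) (a : scalars R k) :
  0 <= modulus a.
Proof.
by case: k a => a; [exact: normr_ge0 | rewrite modulus_complex sqrtr_ge0].
Qed.

Lemma modulusM (R : realType) (k : scalar_kind) (a b : scalars R k) :
  modulus (a * b) = modulus a * modulus b.
Proof.
case: k a b => a b; first exact: normrM.
have := @normrM R[i] a b; rewrite !normc_def -rmorphM.
by rewrite !modulus_complex => -[].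
Qed.

Lemma modulus1 (R : realType) (k : scalar_kind) :
  modulus (1 : scalars R k) = 1.
Proof.
have := modulusM (-1 : scalars R k) (-1); rewrite mulrNN mulr1 => ->.
by rewrite (modulusN1 R k) mulr1.
Qed.

Lemma normr_Re_le_modulus (R : realType) (a : R[i]) :
  `|complex.Re a| <= modulus (a : scalars R ComplexScalars).
Proof.
by rewrite modulus_complex -sqrtr_sqr ler_wsqrtr // lerDl sqr_ge0.
Qed.

Lemma normr_Im_le_modulus (R : realType) (a : R[i]) :
  `|complex.Im a| <= modulus (a : scalars R ComplexScalars).
Proof.
by rewrite modulus_complex -sqrtr_sqr ler_wsqrtr // lerDr sqr_ge0.
Qed.

(** Coercivity confines the values below [f 0] to a compact interval, where the
    extreme value theorem applies. *)
Lemma lipschitz_coercive_min_real (R : realType) (f : R -> R) (c d : R) :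
  0 < c -> (forall s t, f s <= f t + c * `|s - t|) ->
  (forall t, c * `|t| <= f t + d) ->
  exists s, forall t, f s <= f t.
Proof.
move=> c0 flip fcoer.
have f0d : 0 <= f 0 + d by have := fcoer 0; rewrite normr0 mulr0.
(* Where [T < `|t|], coercivity gives [f 0 < f t]. *)
set T := (f 0 + d) / c.
have T0 : 0 <= T by rewrite divr_ge0 // ltW.
have fcont : continuous f.
  move=> t; apply/cvgrPdist_lt => e e0.
  near=> s.
  have st : `|t - s| < e / c.
    near: s; apply: (@cvgr_dist_lt _ _ _ _ _ id t); first exact: cvg_id.
    by rewrite divr_gt0.
  have cst : c * `|t - s| < e by rewrite mulrC -ltr_pdivlMr.
  have := flip t s; have := flip s t; rewrite distrC => h1 h2.
  rewrite ltr_norml; apply/andP; split; lra.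
have [|s _ smin] := @EVT_min R f (- T) T _ (continuous_subspaceT fcont).
  lra.
exists s => t; have [tT|tT] := leP `|t| T.
  by apply: smin; rewrite in_itv /= -ler_norml.
apply: (@le_trans _ _ (f 0)); first by apply: smin; rewrite in_itv /=; lra.
have : f 0 + d < c * `|t| by rewrite mulrC -ltr_pdivrMr.
have := fcoer t; lra.
Unshelve. all: by end_near.
Qed.

(** The complex case is two real minimisations: minimise over the real part
    for each fixed imaginary part [t], then over [t].  The partial minimum is
    again Lipschitz and coercive, so no topology on the complex plane enters. *)
Lemma lipschitz_coercive_min (R : realType) (k : scalar_kind)
    (g : scalars R k -> R) (c d : R) :
  0 < c -> (forall a b, g a <= g b + c * modulus (a - b)) ->
  (forall a, c * modulus a <= g a + d) ->
  exists a, forall b, g a <= g b.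
Proof.
case: k g => g c0 glip gcoer.
  exact: (lipschitz_coercive_min_real c0 glip gcoer).
have lip_re (s s' t : R) : g (s +i* t) <= g (s' +i* t) + c * `|s - s'|.
  have := glip (s +i* t) (s' +i* t).
  by rewrite modulus_complex /= subrr expr0n addr0 sqrtr_sqr.
have lip_im (s t t' : R) : g (s +i* t) <= g (s +i* t') + c * `|t - t'|.
  have := glip (s +i* t) (s +i* t').
  by rewrite modulus_complex /= subrr expr0n add0r sqrtr_sqr.
have row_min (t : R) : exists s, forall s', g (s +i* t) <= g (s' +i* t).
  apply: (@lipschitz_coercive_min_real R (fun s => g (s +i* t)) c d) => // s.
  apply: le_trans (gcoer _); apply: ler_wpM2l; first exact: ltW.
  exact: (normr_Re_le_modulus (s +i* t)).
have [s sP] := choice row_min.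
have [|t|t tP] := @lipschitz_coercive_min_real R (fun t => g (s t +i* t)) c d c0.
- by move=> t t'; apply: le_trans (sP t (s t')) (lip_im _ _ _).
- apply: le_trans (gcoer _); apply: ler_wpM2l; first exact: ltW.
  exact: (normr_Im_le_modulus (s t +i* t)).
by exists (s t +i* t) => -[s' t']; exact: le_trans (tP t') (sP t' s').
Qed.

Lemma seminorm0 (R : realType) (k : scalar_kind) (X : lmodType (scalars R k))
    (S : X -> R) (hS : seminorm_on S) :
  S 0 = 0.
Proof. by rewrite -(scale0r 0) (seminormZ hS) modulus0 mul0r. Qed.

Lemma seminormN (R : realType) (k : scalar_kind) (X : lmodType (scalars R k))
    (S : X -> R) (hS : seminorm_on S) (x : X) :
  S (- x) = S x.
Proof. by rewrite -scaleN1r (seminormZ hS) modulusN1 mul1r. Qed.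

Lemma seminorm_dist (R : realType) (k : scalar_kind) (X : lmodType (scalars R k))
    (S : X -> R) (hS : seminorm_on S) (x y : X) :
  `|S x - S y| <= S (x - y).
Proof.
have := seminormD hS (x - y) y; rewrite subrK.
have := seminormD hS (y - x) x; rewrite subrK -(opprB x y) (seminormN hS).
by move=> h1 h2; rewrite ler_norml; apply/andP; split; lra.
Qed.

Lemma nearest_point_on_line (R : realType) (k : scalar_kind)
    (X : lmodType (scalars R k)) (N : X -> R) (hN : norm_on N) (v : X) (x : X) :
  v != 0 -> exists a, forall b, N (x - a *: v) <= N (x - b *: v).
Proof.
move=> v0; have sN := norm_seminorm hN.
apply: (@lipschitz_coercive_min R k (fun a => N (x - a *: v)) (N v) (N x)).
- exact: (norm_gt0 hN).
- move=> a b; rewrite mulrC -(seminormZ sN) -(seminormN sN (_ *: v)).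
  apply: le_trans (seminormD sN _ _).
  by rewrite scalerBl opprB addrA subrK.
- move=> a; rewrite mulrC -(seminormZ sN) -(seminormN sN (x - _)).
  by apply: le_trans (seminormD sN _ _); rewrite opprB subrK.
Qed.

(** The distance to the line spanned by [v], realised as [N (x - p x *: v)] with
    [p x *: v] a nearest point to [x]. *)
Lemma dist_line_seminorm (R : realType) (k : scalar_kind)
    (X : lmodType (scalars R k)) (N : X -> R) (hN : norm_on N) (v : X) :
  v != 0 -> exists S : X -> R,
  [/\ seminorm_on S, forall x, S x <= N x, S v = 0
    & forall x, S x = 0 -> exists a, x = a *: v].
Proof.
move=> v0; have sN := norm_seminorm hN.
have [p pP] := choice (fun x => nearest_point_on_line hN x v0).
pose S x := N (x - p x *: v).
have S_le x b : S x <= N (x - b *: v) by exact: pP.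
have SZ_le a x : S (a *: x) <= modulus a * S x.
  by rewrite -(seminormZ sN) scalerBr scalerA; exact: S_le.
have S_ge0 x : 0 <= S x by exact: (seminorm_ge0 sN).
exists S; split.
- split=> //.
  + move=> a x; apply/eqP; rewrite eq_le SZ_le /=.
    have [->|a0] := eqVneq a 0; first by rewrite modulus0 mul0r S_ge0.
    (* The converse inequality is the same one, applied to [a^-1]. *)
    have := SZ_le a^-1 (a *: x); rewrite scalerA mulVf // scale1r.
    move=> /(ler_wpM2l (modulus_ge0 a)).
    by rewrite mulrA -modulusM divff // modulus1 mul1r.
  + move=> x y; apply: le_trans (seminormD sN _ _).
    by rewrite addrACA -opprD -scalerDl; exact: S_le.
- by move=> x; have := S_le x 0; rewrite scale0r subr0.
- apply/eqP; rewrite eq_le S_ge0 andbT.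
  by have := S_le v 1; rewrite scale1r subrr (seminorm0 sN).
- move=> x Sx0; exists (p x); apply/eqP; rewrite -subr_eq0.
  by apply/negPn/negP => /(norm_gt0 hN); rewrite -/(S x) Sx0 ltxx.
Qed.

(** A space without such a pair is zero or a line, hence isomorphic to F^0 or
    F^1. *)
Lemma infinite_dimensional_independent_pair (F : fieldType) (X : lmodType F) :
  infinite_dimensional X ->
  exists v w : X, v != 0 /\ forall a, w <> a *: v.
Proof.
move=> infX.
have [v v0] : exists v : X, v != 0.
  apply: contrapT => noX; apply: (infX 0%N); constructor.
  have X0 (x : X) : x = 0 by apply/eqP/negPn/negP => x0; apply: noX; exists x.
  exists (fun=> 0); first by move=> a x y; rewrite scaler0 addr0.
  by exists (fun=> 0) => [x|r]; [rewrite (X0 x) | rewrite [r]thinmx0].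
exists v; apply: contrapT => noW; apply: (infX 1%N); constructor.
have spanv (x : X) : exists a, x = a *: v.
  apply: contrapT => nx; apply: noW; exists x; split => // a xa.
  by apply: nx; exists a.
have [p pP] := choice spanv.
have v_inj (a b : F) : a *: v = b *: v -> a = b.
  move=> /eqP; rewrite -subr_eq0 -scalerBl scaler_eq0 (negPf v0) orbF subr_eq0.
  by move/eqP.
exists (fun x => const_mx (p x)).
  move=> a x y; apply/rowP => i; rewrite !mxE.
  by apply: v_inj; rewrite -pP scalerDl -scalerA -!pP.
exists (fun r : 'rV_1 => r 0 0 *: v) => [x|r]; first by rewrite mxE -pP.
by apply/rowP => i; rewrite mxE (ord1 i); apply: v_inj; rewrite -pP.
Qed.

(** The reverse triangle inequality bounds [|S x - S y|] by [N (x - y)]. *)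
Lemma dominated_seminorm_continuous (R : realType) (k : scalar_kind)
    (X : lmodType (scalars R k)) (N : X -> R) (hN : norm_on N) (S : X -> R) :
  seminorm_on S -> (forall x, S x <= N x) -> ubiquitously_continuous hN S.
Proof.
move=> hS SN x.
apply/(@cvgrPdist_lt _ _ _ (nbhs (x : normed_by hN)) (nbhs_filter _)) => e e0.
apply/nbhs_ballP; exists e => //= y xy.
exact: le_lt_trans (le_trans (seminorm_dist hS x y) (SN _)) xy.
Qed.

Theorem theorem5 (R : realType) (k : scalar_kind) (X : lmodType (scalars R k))
    (N : X -> R) (hN : norm_on N) :
  infinite_dimensional X ->
  exists S : X -> R, proper_seminorm S /\ ubiquitously_continuous hN S.
Proof.
move=> /infinite_dimensional_independent_pair[v [w [v0 wv]]].
have [S [hS SN Sv kerS]] := dist_line_seminorm hN v0.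
exists S; split; last exact: dominated_seminorm_continuous.
split=> //; last by exists v.
by exists w; apply/eqP => /kerS[a]; exact: wv.
Qed.
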